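(* Work in the setting described in the context. Assume: (i) (Convexity) for every $\omega\in\Omega$ the map $\beta\mapsto L(f_\beta,\omega)$ is convex on $\mathbb{R}^p$; (ii) (Quadratic margin) there are a constant $c>0$ and a subset $\mathbf{F}_{\mathrm{local}}\subset\mathbf{F}$ such that $\mathcal{E}(f)\ge c\|f-f^0\|^2$ for all $f\in\mathbf{F}_{\mathrm{local}}$; (iii) the positive eigenvalue condition is satisfied with constant $\tau>0$; (iv) $S_*\neq\emptyset$ and the $(3C/\tau^2,S_*,2s_* )$-restricted eigenvalue condition is satisfied with constant $\phi_*\in(0,1]$. Let $\lambda>0$ and set $$\varepsilon_\lambda=4\mathcal{E}(f^* )+\frac{12}{c\phi_*^2}\left(1+\frac{3C}{\tau^2}\right)^2 s_*\lambda^2,\qquad M_\lambda=\frac{\varepsilon_\lambda}{\lambda}.$$ Suppose further that $f^0=f^*$ and that $f_\beta\in\mathbf{F}_{\mathrm{local}}$ for every $\beta\in\mathbb{R}^p$ with $\|\beta-\beta^*\|_1\le M_\lambda$. Then, on the set $\{\mathbf{Z}_{M_\lambda}\le\varepsilon_\lambda\}$, $$\|\hat\beta-\beta^*\|_q^q\le\left\{\frac{12}{c\phi_*^2}\left(1+\frac{3C}{\tau^2}\right)^2\right\}^q s_*\lambda^q\qquad\text{for every } q\in[1,2].$$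
   Context: Let $(\Omega,\mathcal{F},P)$ be a probability space, $\mathbf{F}$ a real inner product space with inner product $\langle\cdot,\cdot\rangle$ and norm $\|\cdot\|$, and $L:\mathbf{F}\times\Omega\to\mathbb{R}$ a function (the empirical loss) such that $L(f)=L(f,\cdot)\in L^1(P)$ for every $f\in\mathbf{F}$. Put $\bar L(f)=E[L(f)]$. Assume there exists $f^0\in\mathbf{F}$ with $\bar L(f^0)=\min_{f\in\mathbf{F}}\bar L(f)$, fix such an $f^0$, and define the excess risk $\mathcal{E}(f)=\bar L(f)-\bar L(f^0)\ge 0$. Let $\psi_1,\dots,\psi_p\in\mathbf{F}$. For $\beta\in\mathbb{R}^p$ put $f_\beta=\sum_{j=1}^p\beta_j\psi_j$. Write $\beta\succeq0$ if $\beta_j\ge0$ for all $j$; $\|\beta\|_q^q=\sum_j|\beta_j|^q$ for $q>0$, $\|\beta\|_\infty=\max_j|\beta_j|$; for $S\subset\{1,\dots,p\}$, $\beta_S\in\mathbb{R}^p$ is the vector with $j$-th entry $\beta_j1_{\{j\in S\}}$. The estimator $\hat\beta$ (assumed to exist) is a random vector with $\hat\beta\succeq0$ and $L(f_{\hat\beta})=\min_{\beta\succeq0}L(f_\beta)$. Fix a (deterministic) vector $\beta^*\in\mathbb{R}^p$ with $\beta^*\succeq0$. Put $f^*=f_{\beta^*}$, $S_*=\{j:\beta^*_j\ne0\}$, $s_*=|S_*|$, $C=\max_{1\le j\le p}\|\psi_j\|^2$. Put $v(\beta)=L(f_\beta)-\bar L(f_\beta)$ and, for $M>0$, $\mathbf{Z}_M=\sup_{\beta\in\mathbb{R}^p:\|\beta-\beta^*\|_1\le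 M}|v(\beta)-v(\beta^* )|$. Let $\Sigma=(\langle\psi_i,\psi_j\rangle)_{1\le i,j\le p}$ be the Gram matrix. Restricted eigenvalue condition: for $S\subset\mathcal{N}\subset\{1,\dots,p\}$ and $\Lambda\ge0$ let $$\mathcal{R}(\Lambda,S,\mathcal{N})=\Big\{\beta\in\mathbb{R}^p:\|\beta_{S^c}\|_1\le \Lambda\|\beta_S\|_1,\ \|\beta_{\mathcal{N}^c}\|_\infty\le\min_{j\in\mathcal{N}\setminus S}|\beta_j|\Big\}.$$ For an integer $N$ with $|S|\le N\le p$, the $(\Lambda,S,N)$-restricted eigenvalue condition is satisfied with constant $\phi>0$ if for all $\mathcal{N}\subset\{1,\dots,p\}$ with $\mathcal{N}\supset S$, $|\mathcal{N}|=N$, and all $\beta\in\mathcal{R}(\Lambda,S,\mathcal{N})$, one has $\|\beta_{\mathcal{N}}\|_2^2\le\beta^\top\Sigma\beta/\phi^2$. (In particular, assuming the condition with $N=2s_*$ includes $2s_*\le p$.) Positive eigenvalue condition: it is satisfied with constant $\tau>0$ if $\beta^\top\Sigma\beta\ge\tau^2$ for all $\beta\in\mathbb{R}^p$ with $\|\beta\|_1=1$ and $\beta\succeq0$. *)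

(* Defs.v *)
From HB Require Import structures.
From mathcomp Require Import all_boot all_order all_algebra.
From mathcomp Require Import all_classical all_reals all_analysis.

Set Implicit Arguments.
Unset Strict Implicit.
Unset Printing Implicit Defensive.

Import Order.TTheory GRing.Theory Num.Theory.
Local Open Scope classical_set_scope.
Local Open Scope ring_scope.

Section coefficient_vectors.
Context {R : realType} {p : nat}.
Implicit Types (b : 'cV[R]_p) (S N : {set 'I_p}).

Definition vnonneg b : Prop := forall j, 0 <= b j 0.

Definition norm1 b : R := \sum_j `|b j 0|.

(* The q-th power of the l_q norm, for a real exponent q > 0. *)
Definition normpow (q : R) b : R := \sum_j `|b j 0| `^ q.

Definition norminf b : R := \big[Num.max/0]_j `|b j 0|.

Definition vrestr S b : 'cV[R]_p := \col_j (b j 0 * (j \in S)%:R).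

Definition vsupp b : {set 'I_p} := [set j | b j 0 != 0]%SET.

Definition quadform (A : 'M[R]_p) b : R := (b^T *m A *m b) 0 0.

(* The minimum is taken in the extended reals, so that it is +oo when N = S. *)
Definition restricted_set (La : R) S N : set 'cV[R]_p :=
  [set b | norm1 (vrestr (~: S) b) <= La * norm1 (vrestr S b) /\
    ((norminf (vrestr (~: N) b))%:E <=
       \big[Order.min/+oo]_(j in N :\: S) `|b j 0|%:E)%E].

Definition restricted_eigenvalue (A : 'M[R]_p) (La : R) S (n : nat) (phi : R)
    : Prop :=
  (#|S| <= n <= p)%N /\
  forall N : {set 'I_p}, S \subset N -> #|N| = n ->
  forall b, restricted_set La S N b ->
    normpow 2 (vrestr N b) <= quadform A b / phi ^+ 2.

Definition positive_eigenvalue (A : 'M[R]_p) (tau : R) : Prop :=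
  forall b, norm1 b = 1 -> vnonneg b -> tau ^+ 2 <= quadform A b.

End coefficient_vectors.

Section inner_product_space.
Context {R : realType} {F : lmodType R} (ip : {dot F for idfun}) {p : nat}.
Implicit Type psi : 'I_p -> F.

Definition inorm (f : F) : R := Num.sqrt (ip f f).

Definition gram psi : 'M[R]_p := \matrix_(i, j) ip (psi i) (psi j).

Definition maxnorm2 psi : R := \big[Num.max/0]_j inorm (psi j) ^+ 2.

End inner_product_space.

Definition lincomb {R : realType} {F : lmodType R} {p : nat}
  (psi : 'I_p -> F) (b : 'cV[R]_p) : F := \sum_j b j 0 *: psi j.

Section empirical_loss.
Context {d : measure_display} {T : measurableType d} {R : realType}.
Context (P : probability T R) {F : lmodType R} (L : F -> T -> R).

(* fine is harmless here: L f is assumed integrable. *)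
Definition risk (f : F) : R := fine ('E_P[L f])%E.

Definition excess_risk (f0 f : F) : R := risk f - risk f0.

Context {p : nat} (psi : 'I_p -> F).

Definition emp_process (b : 'cV[R]_p) (w : T) : R :=
  L (lincomb psi b) w - risk (lincomb psi b).

(* Extended-real valued, since the supremum may be infinite. *)
Definition sup_process (bstar : 'cV[R]_p) (M : R) (w : T) : \bar R :=
  ereal_sup [set `|emp_process b w - emp_process bstar w|%:E |
    b in [set b : 'cV[R]_p | norm1 (b - bstar) <= M]].

(* A random vector minimising the empirical loss over nonnegative
   coefficients; measurability is meant coordinatewise. *)
Definition nonneg_estimator (bhat : T -> 'cV[R]_p) : Prop :=
  (forall j, measurable_fun setT (fun w => bhat w j 0)) /\
  forall w, vnonneg (bhat w) /\
    forall b, vnonneg b -> L (lincomb psi (bhat w)) w <= L (lincomb psi b) w.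

End empirical_loss.

Definition rate_const {R : realType} (c phi tau C : R) : R :=
  12 / (c * phi ^+ 2) * (1 + 3 * C / tau ^+ 2) ^+ 2.

(* Main.v *)
Require Import Defs.
From HB Require Import structures.
From mathcomp Require Import all_boot all_order all_algebra.
From mathcomp Require Import all_classical all_reals all_analysis.
From mathcomp Require Import ring lra.

Set Implicit Arguments.
Unset Strict Implicit.
Unset Printing Implicit Defensive.

Import Order.TTheory GRing.Theory Num.Theory.
Local Open Scope classical_set_scope.
Local Open Scope ring_scope.

(** Write [Q b] for [b^T Sigma b], which is the squared norm of [lincomb psi b],
    [S] for the support of [bstar], [s = #|S|], [La = 3 C / tau^2] and
    [B = (1 + La)^2 / phi^2], so that [K = 12 B / c].  Since [f0 = lincomb psi
    bstar], the approximation error vanishes and [eps = K s lambda^2],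
    [M = K s lambda].

    The heart of the proof is deterministic ([norm_bounds]): a vector [b] which
    is nonnegative off [S] satisfies [norm1 b ^ 2 <= s B Q b] and
    [normpow 2 b <= B Q b].  If [b] lies in the cone
    [norm1 b_(S^c) <= La norm1 b_S], this is the restricted eigenvalue
    condition, applied to [S] enlarged by the [s] largest entries off [S]
    ([cone_bounds]).  Otherwise the nonnegative part [b_(S^c)] dominates, and
    the positive eigenvalue condition prevents it from being cancelled by
    [b_S] ([off_cone_bound]).  The resulting constant [4 / tau^2] is absorbed
    in [B], because testing the two eigenvalue conditions on coordinate vectors
    gives [tau^2 <= C] and [phi^2 <= C].

    The rest is localisation.  Let [D] be the estimation error, and move from
    [bstar] towards the estimator by a fraction [t] such that
    [norm1 (t D) <= M].  By convexity the empirical loss at that point is at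
    most the one at [bstar], so on the event considered its excess risk is at
    most [eps], the margin condition gives [c Q (t D) <= eps], and
    [norm_bounds] improves [norm1 (t D) <= M] to [norm1 (t D) <= M / 2].
    With [t = M / (M + norm1 D)] this forces [norm1 D <= M], so [t = 1] is
    allowed too, and [norm_bounds] now yields the cases [q = 1] and [q = 2].
    The exponents in between follow by interpolation ([normpow_interp]). *)

(** * Coefficient vectors *)

Section coefficient_vectors.
Context {R : realType} {p : nat}.
Implicit Types (b : 'cV[R]_p) (S N : {set 'I_p}).

Lemma norm1_ge0 b : 0 <= norm1 b.
Proof. by apply: sumr_ge0 => j _. Qed.

Lemma norm1Z (a : R) b : norm1 (a *: b) = `|a| * norm1 b.
Proof.
by rewrite /norm1 mulr_sumr; apply: eq_bigr => j _; rewrite mxE normrM.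
Qed.

Lemma norm1_vrestr S b : norm1 (vrestr S b) = \sum_(j in S) `|b j 0|.
Proof.
rewrite /norm1 [RHS]big_mkcond; apply: eq_bigr => j _.
by rewrite mxE; case: (j \in S); rewrite ?mulr1 // mulr0 normr0.
Qed.

Lemma vrestrD S b : vrestr S b + vrestr (~: S) b = b.
Proof.
apply/colP => j; rewrite !mxE inE.
by case: (j \in S); rewrite ?mulr1 ?mulr0 ?addr0 ?add0r.
Qed.

Lemma norm1_split S b : norm1 b = norm1 (vrestr S b) + norm1 (vrestr (~: S) b).
Proof.
rewrite !norm1_vrestr /norm1 (bigID (mem S)) /=; congr (_ + _).
by apply: eq_bigl => j; rewrite inE.
Qed.

Lemma normpow2 b : normpow 2 b = \sum_j b j 0 ^+ 2.
Proof.
by apply: eq_bigr => j _; rewrite powR_mulrn // real_normK ?num_real.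
Qed.

Lemma normpow2_vrestr S b : normpow 2 (vrestr S b) = \sum_(j in S) b j 0 ^+ 2.
Proof.
rewrite normpow2 [RHS]big_mkcond; apply: eq_bigr => j _.
by rewrite mxE; case: (j \in S); rewrite ?mulr1 // mulr0 expr0n.
Qed.

Lemma normpow2_split S b :
  normpow 2 b = normpow 2 (vrestr S b) + normpow 2 (vrestr (~: S) b).
Proof.
rewrite !normpow2_vrestr normpow2 (bigID (mem S)) /=; congr (_ + _).
by apply: eq_bigl => j; rewrite inE.
Qed.

Lemma normpow2_ge0 b : 0 <= normpow 2 b.
Proof. by rewrite normpow2; apply: sumr_ge0 => j _; apply: sqr_ge0. Qed.

Lemma normpow2_vrestrS S N b :
  S \subset N -> normpow 2 (vrestr S b) <= normpow 2 (vrestr N b).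
Proof.
move=> SN; rewrite !normpow2_vrestr [leRHS](big_setID S) /= (finset.setIidPr SN).
by rewrite lerDl; apply: sumr_ge0 => j _; apply: sqr_ge0.
Qed.

Lemma normpow2_le_norm1 b : normpow 2 b <= norm1 b ^+ 2.
Proof.
rewrite normpow2 expr2 {1}/norm1 mulr_suml; apply: ler_sum => j _.
rewrite -real_normK ?num_real // expr2 ler_wpM2l //.
by rewrite /norm1 (bigD1 j) //= lerDl sumr_ge0.
Qed.

(** Cauchy-Schwarz against the indicator of [S]; summing
    [2 |b_i| |b_j| <= b_i^2 + b_j^2] over [S * S] is enough. *)
Lemma norm1_vrestr_sqr S b :
  norm1 (vrestr S b) ^+ 2 <= #|S|%:R * normpow 2 (vrestr S b).
Proof.
rewrite norm1_vrestr normpow2_vrestr expr2.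
set A := \sum_(j in S) _ ^+ 2.
have E : #|S|%:R * A
    = \sum_(i in S) \sum_(j in S) (b i 0 ^+ 2 + b j 0 ^+ 2) / 2.
  under eq_bigr => i _ do rewrite -mulr_suml big_split /= sumr_const -/A.
  rewrite -mulr_suml big_split /= sumr_const sumrMnl -/A.
  by rewrite -[A *+ _]mulr_natl; field.
rewrite E mulr_suml; apply: ler_sum => i _.
rewrite mulr_sumr; apply: ler_sum => j _.
rewrite -(real_normK (num_real (b i 0))) -(real_normK (num_real (b j 0))).
have := sqr_ge0 (`|b i 0| - `|b j 0|); nra.
Qed.

(** Greedy choice: [S] is enlarged one element at a time by a maximiser of [f]
    among the remaining indices. *)
Lemma exists_top_set (f : 'I_p -> R) S n : (#|S| <= n <= p)%N ->
  exists N : {set 'I_p}, [/\ S \subset N, #|N| = n &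
    forall i j, i \notin N -> j \in N :\: S -> f i <= f j].
Proof.
move=> /andP[Sn]; rewrite -(subnKC Sn); elim: (n - #|S|)%N => [|k IH] np.
  exists S; split; rewrite ?addn0 // => i j _; rewrite finset.setDv finset.in_set0 //.
have [|N [SN cN topN]] := IH; first by apply: leq_trans np; rewrite leq_add2l.
have /finset.set0Pn[i0 i0N] : ~: N != finset.set0.
  by rewrite -card_gt0 cardsCs finset.setCK cN card_ord subn_gt0 -ltnS -addnS.
rewrite finset.in_setC in i0N.
case: (@arg_maxP _ _ _ i0 (fun i => i \notin N) f i0N) => i iN imax.
exists (i |: N); split.
- by apply: fintype.subset_trans SN _; apply: finset.subsetUr.
- by rewrite cardsU1 iN cN addnS add1n.
move=> l j; rewrite !inE negb_or => /andP[li lN] /andP[jS] /orP[/eqP->|jN].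
  exact: imax.
by apply: topN; rewrite // inE jS.
Qed.

(** Makes the restricted eigenvalue condition usable for every vector of the
    cone; the comparison between single entries is what [normpow2_tail]
    needs. *)
Lemma exists_restricted_set La S n b : (#|S| <= n <= p)%N ->
  norm1 (vrestr (~: S) b) <= La * norm1 (vrestr S b) ->
  exists N : {set 'I_p}, [/\ S \subset N, #|N| = n,
    forall i j, i \notin N -> j \in N :\: S -> `|b i 0| <= `|b j 0| &
    restricted_set La S N b].
Proof.
move=> Snp cone; have [N [SN cN topN]] := exists_top_set (fun j => `|b j 0|) Snp.
exists N; split => //; split => //.
apply: le_bigmin => [|j jN]; first exact: leey.
rewrite lee_fin; apply: bigmax_le => // i _; rewrite mxE inE.
by case: (boolP (i \in N)) => iN; rewrite ?mulr0 ?normr0 // mulr1; apply: topN.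
Qed.

(** Each entry off [N] is at most the average of [|b|] over [N :\: S]; hence,
    with [x] and [y] the l1 norms over [N :\: S] and off [N], the left-hand
    side is at most [x y <= (x + y)^2]. *)
Lemma normpow2_tail S N b :
  (forall i j, i \notin N -> j \in N :\: S -> `|b i 0| <= `|b j 0|) ->
  S \subset N ->
  #|N :\: S|%:R * normpow 2 (vrestr (~: N) b) <= norm1 (vrestr (~: S) b) ^+ 2.
Proof.
move=> topN SN; rewrite normpow2_vrestr norm1_vrestr.
have -> : \sum_(j in ~: S) `|b j 0| =
    \sum_(j in N :\: S) `|b j 0| + \sum_(j in ~: N) `|b j 0|.
  rewrite (bigID (mem N)) /=; congr (_ + _); apply: eq_bigl => j; rewrite !inE //.
  by case: (boolP (j \in S)) => //= /(fintype.subsetP SN) ->.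
set x : R := \sum_(j in N :\: S) _; set y : R := \sum_(j in ~: N) `|_|.
have x0 : 0 <= x by apply: sumr_ge0 => j _.
have y0 : 0 <= y by apply: sumr_ge0 => j _.
have : #|N :\: S|%:R * \sum_(j in ~: N) b j 0 ^+ 2 <= x * y.
  rewrite !mulr_sumr; apply: ler_sum => i; rewrite inE => iN.
  rewrite -real_normK ?num_real // expr2 mulrA ler_wpM2r //.
  by rewrite mulr_natl -sumr_const; apply: ler_sum => j; apply: topN.
move=> h; apply: (le_trans h); nra.
Qed.

Lemma quadformZ (A : 'M[R]_p) a b : quadform A (a *: b) = a ^+ 2 * quadform A b.
Proof.
by rewrite /quadform -scalemxAr [(a *: b)^T]linearZ /= -!scalemxAl scalerA mxE expr2.
Qed.

Lemma quadform0 (A : 'M[R]_p) : quadform A 0 = 0.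
Proof. by rewrite /quadform mulmx0 mxE. Qed.

(** The positive eigenvalue condition, extended from the simplex by
    homogeneity. *)
Lemma positive_eigenvalue_norm1 (A : 'M[R]_p) tau b :
  positive_eigenvalue A tau -> vnonneg b ->
  tau ^+ 2 * norm1 b ^+ 2 <= quadform A b.
Proof.
move=> pe b0; have [n0|n0] := eqVneq (norm1 b) 0.
  have -> : b = 0.
    apply/colP => j; rewrite mxE; apply/eqP; rewrite -normr_eq0; move/eqP: n0.
    by rewrite psumr_eq0 // => /allP /(_ j); rewrite mem_index_enum => /(_ isT).
  by rewrite quadform0 /norm1 big1 ?expr0n ?mulr0 // => j _; rewrite mxE normr0.
have npos : 0 < norm1 b by rewrite lt0r n0 norm1_ge0.
have {pe} : tau ^+ 2 <= quadform A ((norm1 b)^-1 *: b).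
  apply: pe => [|j]; first by rewrite norm1Z ger0_norm ?invr_ge0 ?norm1_ge0 // mulVf.
  by rewrite mxE mulr_ge0 ?invr_ge0 ?norm1_ge0.
by rewrite quadformZ exprVn mulrC ler_pdivlMr // exprn_gt0.
Qed.

Lemma norm1_delta (j : 'I_p) : norm1 (delta_mx j 0 : 'cV[R]_p) = 1.
Proof.
rewrite /norm1 (bigD1 j) //= big1 => [|i /negPf ij].
  by rewrite mxE !eqxx normr1 addr0.
by rewrite mxE ij normr0.
Qed.

End coefficient_vectors.

(** * The Gram quadratic form *)

Section inner_product_space.
Context {R : realType} {F : lmodType R} (ip : {dot F for idfun}) {p : nat}.
Implicit Types (psi : 'I_p -> F) (u v : F) (La tau phi : R) (b : 'cV[R]_p).

Lemma ipC u v : ip u v = ip v u.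
Proof. by rewrite hermC expr0 mul1r. Qed.

Lemma ip_ge0 u : 0 <= ip u u.
Proof.
have [->|u0] := eqVneq u 0; first by rewrite linear0l.
exact/ltW/neq0_dnorm_gt0.
Qed.

Lemma inorm_sqr u : inorm ip u ^+ 2 = ip u u.
Proof. by rewrite sqr_sqrtr ?ip_ge0. Qed.

Lemma ip_sqrD u v : ip (u + v) (u + v) = ip u u + 2 * ip u v + ip v v.
Proof. by rewrite (linearDl ip) !(linearDr ip) /= (ipC v u); ring. Qed.

(** A substitute for the reverse triangle inequality which avoids square roots:
    the difference of the two sides is a third of the squared norm of
    [3 *: u + v].  The weights are those that [off_cone_bound] needs. *)
Lemma ip_peel u v : 2 / 3 * ip v v - 2 * ip u u <= ip (u + v) (u + v).
Proof.
have := ip_ge0 (3 *: u + v).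
rewrite !ip_sqrD (linearZl_LR ip) (linearZr_LR ip u) (linearZl_LR ip) /=; lra.
Qed.

Lemma lincombD psi (a b : 'cV[R]_p) :
  lincomb psi (a + b) = lincomb psi a + lincomb psi b.
Proof.
by rewrite /lincomb -big_split; apply: eq_bigr => j _; rewrite mxE scalerDl.
Qed.

Lemma lincombB psi (a b : 'cV[R]_p) :
  lincomb psi (a - b) = lincomb psi a - lincomb psi b.
Proof.
rewrite /lincomb -sumrB; apply: eq_bigr => j _.
by rewrite !mxE scalerBl.
Qed.

Lemma quadform_gram psi b :
  quadform (gram ip psi) b = ip (lincomb psi b) (lincomb psi b).
Proof.
rewrite /quadform /lincomb mxE linear_sumr; apply: eq_bigr => j _.
rewrite linearZr_LR /= linear_sumlz mxE mulrC; congr (_ * _).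
by apply: eq_bigr => i _; rewrite !mxE linearZl_LR.
Qed.

Lemma ip_le_maxnorm2 psi i j : `|ip (psi i) (psi j)| <= maxnorm2 ip psi.
Proof.
have psi_le k : ip (psi k) (psi k) <= maxnorm2 ip psi.
  by rewrite -inorm_sqr; apply: (le_bigmax 0 (fun k => inorm ip (psi k) ^+ 2)).
have := ip_ge0 (psi i - psi j); have := ip_ge0 (psi i + psi j).
rewrite !ip_sqrD (linearNr ip) (linearNl ip) (linearNr ip).
move: (psi_le i) (psi_le j) => hi hj h1 h2.
by rewrite ler_norml; apply/andP; split; lra.
Qed.

Lemma quadform_gram_le psi b :
  quadform (gram ip psi) b <= maxnorm2 ip psi * norm1 b ^+ 2.
Proof.
rewrite quadform_gram /lincomb linear_sumlz expr2 mulrA mulrC {1}/norm1 mulr_suml.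
apply: ler_sum => i _; rewrite linearZl_LR linear_sumr /= !mulr_sumr.
apply: ler_sum => j _; rewrite linearZr_LR /=.
apply: (le_trans (ler_norm _)); rewrite !normrM ler_wpM2l //.
by rewrite mulrC ler_wpM2r // ip_le_maxnorm2.
Qed.

(** The condition is tested on a coordinate vector. *)
Lemma positive_eigenvalue_le_maxnorm2 psi tau (j : 'I_p) :
  positive_eigenvalue (gram ip psi) tau -> tau ^+ 2 <= maxnorm2 ip psi.
Proof.
move=> pe; have := quadform_gram_le psi (delta_mx j 0).
rewrite norm1_delta expr1n mulr1; apply: le_trans; apply: pe.
  exact: norm1_delta.
by move=> i; rewrite mxE ler0n.
Qed.

(** A coordinate vector with index in [S] vanishes off [S], so it lies in every
    cone and the restricted eigenvalue condition applies to it. *)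
Lemma restricted_eigenvalue_le_maxnorm2 psi La (S : {set 'I_p}) n phi j :
  0 <= La -> 0 < phi -> j \in S ->
  restricted_eigenvalue (gram ip psi) La S n phi ->
  phi ^+ 2 <= maxnorm2 ip psi.
Proof.
move=> La0 phi0 jS [Snp re].
pose e : 'cV[R]_p := delta_mx j 0.
have cone : norm1 (vrestr (~: S) e) <= La * norm1 (vrestr S e).
  rewrite [leLHS](_ : _ = 0) ?mulr_ge0 ?norm1_ge0 //.
  rewrite norm1_vrestr big1 // => i; rewrite inE mxE => iS.
  by rewrite (negPf (_ : i != j)) ?normr0 //; apply: contraNneq iS => ->.
have [N [SN cN _ rN]] := exists_restricted_set Snp cone.
have := re N SN cN e rN; rewrite ler_pdivlMr ?exprn_gt0 //.
have : 1 <= normpow 2 (vrestr N e).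
  rewrite normpow2_vrestr (bigD1 j) /=; last exact: (fintype.subsetP SN).
  by rewrite mxE !eqxx expr1n lerDl; apply: sumr_ge0 => i _; apply: sqr_ge0.
have := quadform_gram_le psi e; rewrite norm1_delta expr1n mulr1.
have : 0 < phi ^+ 2 by rewrite exprn_gt0.
nra.
Qed.

(** Let [N] be [S] together with the [#|S|] largest entries off [S].  The
    condition bounds the l2 norm over [N], hence the l1 norm over [S] by
    Cauchy-Schwarz; the cone inequality transfers the latter to the l1 norm
    off [S], and [normpow2_tail] then controls the l2 norm off [N]. *)
Lemma cone_bounds psi La (S : {set 'I_p}) phi b :
  0 <= La -> 0 < phi -> S != finset.set0 ->
  restricted_eigenvalue (gram ip psi) La S (2 * #|S|) phi ->
  norm1 (vrestr (~: S) b) <= La * norm1 (vrestr S b) ->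
  let B := (1 + La) ^+ 2 / phi ^+ 2 in
  norm1 b ^+ 2 <= #|S|%:R * (B * quadform (gram ip psi) b) /\
  normpow 2 b <= B * quadform (gram ip psi) b.
Proof.
move=> La0 phi0 Sn0 [Snp re] cone B.
have [N [SN cN topN rN]] := exists_restricted_set Snp cone.
have s0 : 0 < #|S|%:R :> R by rewrite ltr0n card_gt0.
have tail := normpow2_tail topN SN.
have cNS : #|N :\: S| = #|S|.
  by rewrite cardsDS // cN mul2n -addnn addnK.
rewrite cNS in tail.
have S2 := norm1_vrestr_sqr S b; have SN2 := normpow2_vrestrS b SN.
have := re N SN cN b rN.
rewrite {}/B -mulrA [(phi ^+ 2)^-1 * _]mulrC (norm1_split S) (normpow2_split N b).
(* The statement is now about real numbers: [x] and [y] are the l1 norms on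
   and off [S], and [t], [n] and [m] the squared l2 norms on [S], on [N] and
   off [N]. *)
move: (quadform _ _ / _) (norm1_ge0 (vrestr S b)) (norm1_ge0 (vrestr (~: S) b)).
move: S2 SN2 tail cone (normpow2_ge0 (vrestr N b)).
move: (norm1 (vrestr S b)) (norm1 (vrestr (~: S) b)) => x y.
move: (normpow _ _) (normpow _ _) (normpow _ _) => m n t.
move: #|S|%:R s0 => s s0 S2 SN2 tail cone n0 q x0 y0 nq.
have xq : x ^+ 2 <= s * q.
  by apply: (le_trans S2); rewrite ler_wpM2l ?(ltW s0) // (le_trans SN2).
have yq : y ^+ 2 <= La ^+ 2 * x ^+ 2 by rewrite -exprMn ler_pXn2r ?nnegrE ?mulr_ge0.
split.
  have : (x + y) ^+ 2 <= (1 + La) ^+ 2 * x ^+ 2.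
    rewrite -exprMn ler_pXn2r ?nnegrE ?mulr_ge0 ?addr_ge0 //; lra.
  move/le_trans; apply.
  by rewrite [leRHS]mulrCA ler_wpM2l ?exprn_ge0 // addr_ge0.
have mq : m <= La ^+ 2 * q.
  rewrite -(ler_pM2l s0) (le_trans tail) // (le_trans yq) //.
  by rewrite [leRHS]mulrCA ler_wpM2l ?exprn_ge0.
have := ler_wpM2r (le_trans n0 nq) La0; nra.
Qed.

(** Let [x] and [y] be the l1 norms of [b] on and off [S].  Since [b] is
    nonnegative off [S], that part has squared norm at least [tau^2 y^2],
    whereas the part on [S] has squared norm at most [C x^2].  Outside the
    cone, [tau^2 <= C] gives [3 x <= y] and [9 C x^2 <= tau^2 y^2], so that
    [Q b >= (4 / 9) tau^2 y^2] by [ip_peel] and [(x + y)^2 <= (16 / 9) y^2]. *)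
Lemma off_cone_bound psi tau (S : {set 'I_p}) b :
  0 < tau -> S != finset.set0 -> positive_eigenvalue (gram ip psi) tau ->
  (forall j, j \notin S -> 0 <= b j 0) ->
  3 * maxnorm2 ip psi / tau ^+ 2 * norm1 (vrestr S b) <
    norm1 (vrestr (~: S) b) ->
  tau ^+ 2 * norm1 b ^+ 2 <= 4 * quadform (gram ip psi) b.
Proof.
move=> tau0 /finset.set0Pn[j _] pe b0.
have tC := positive_eigenvalue_le_maxnorm2 j pe.
have t20 : 0 < tau ^+ 2 by rewrite exprn_gt0.
rewrite mulrAC ltr_pdivrMr // => off.
have Qu := quadform_gram_le psi (vrestr S b).
have Qv : tau ^+ 2 * norm1 (vrestr (~: S) b) ^+ 2
    <= quadform (gram ip psi) (vrestr (~: S) b).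
  apply: positive_eigenvalue_norm1 => // i; rewrite mxE inE.
  by case: (boolP (i \in S)) => iS; rewrite ?mulr0 ?mulr1 ?b0.
have := ip_peel (lincomb psi (vrestr S b)) (lincomb psi (vrestr (~: S) b)).
rewrite -lincombD vrestrD -!quadform_gram (norm1_split S).
move: Qu Qv off (norm1_ge0 (vrestr S b)) (norm1_ge0 (vrestr (~: S) b)) tC t20.
move: (norm1 (vrestr S b)) (norm1 (vrestr (~: S) b)) (maxnorm2 _ _) => x y C.
move: (quadform _ _) (quadform _ _) (quadform _ _) (tau ^+ 2) => q qv qu t.
move=> Qu Qv off x0 y0 tC t0 Qq.
have x3 : 3 * x <= y.
  by rewrite -(ler_pM2l t0); have := ler_wpM2r x0 tC; lra.
have Cx : 9 * (C * x ^+ 2) <= t * y ^+ 2.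
  have := ler_wpM2r x0 (ltW off); have := ler_wpM2l (mulr_ge0 (ltW t0) y0) x3; lra.
have xy : 9 * (t * (x + y) ^+ 2) <= 16 * (t * y ^+ 2).
  rewrite mulrCA [leRHS]mulrCA ler_pM2l //; nra.
lra.
Qed.

(** Both eigenvalue conditions combined into one estimate, whose constant does
    not depend on whether the vector lies in the cone. *)
Lemma norm_bounds psi tau (S : {set 'I_p}) phi b :
  let La := 3 * maxnorm2 ip psi / tau ^+ 2 in
  let B := (1 + La) ^+ 2 / phi ^+ 2 in
  0 < tau -> 0 < phi -> S != finset.set0 ->
  positive_eigenvalue (gram ip psi) tau ->
  restricted_eigenvalue (gram ip psi) La S (2 * #|S|) phi ->
  (forall j, j \notin S -> 0 <= b j 0) ->
  norm1 b ^+ 2 <= #|S|%:R * (B * quadform (gram ip psi) b) /\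
  normpow 2 b <= B * quadform (gram ip psi) b.
Proof.
move=> La B tau0 phi0 Sn0 pe re b0.
have /finset.set0Pn[j jS] := Sn0.
have t20 : 0 < tau ^+ 2 by rewrite exprn_gt0.
have f20 : 0 < phi ^+ 2 by rewrite exprn_gt0.
have C0 : 0 <= maxnorm2 ip psi := le_trans (normr_ge0 _) (ip_le_maxnorm2 psi j j).
have La0 : 0 <= La by rewrite divr_ge0 ?(ltW t20) ?mulr_ge0.
have [cone|off] := leP (norm1 (vrestr (~: S) b)) (La * norm1 (vrestr S b)).
  exact: cone_bounds.
have Q0 : 0 <= quadform (gram ip psi) b by rewrite quadform_gram ip_ge0.
have fC := restricted_eigenvalue_le_maxnorm2 La0 phi0 jS re.
(* As [phi^2 <= C], this follows from [(1 + La)^2 tau^2 >= 4 La tau^2 = 12 C],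
   with room to spare. *)
have tB : 4 <= B * tau ^+ 2.
  rewrite mulrAC ler_pdivlMr //.
  have LaE : La * tau ^+ 2 = 3 * maxnorm2 ip psi by rewrite divfK ?gt_eqF.
  have : 4 * La * tau ^+ 2 <= (1 + La) ^+ 2 * tau ^+ 2.
    by rewrite ler_pM2r //; have := sqr_ge0 (1 - La); lra.
  lra.
have n1 : norm1 b ^+ 2 <= B * quadform (gram ip psi) b.
  rewrite -(ler_pM2l t20); apply: (le_trans (off_cone_bound tau0 Sn0 pe b0 off)).
  by rewrite mulrA ler_wpM2r // mulrC.
split; last exact: le_trans (normpow2_le_norm1 b) n1.
apply: (le_trans n1); rewrite ler_peMl ?(le_trans _ n1) ?sqr_ge0 //.
by rewrite ler1n card_gt0.
Qed.

End inner_product_space.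

(** * Interpolation between l1 and l2 *)

(** The power [y `^ q] is convex in the exponent [q], being an exponential. *)
Lemma powR_interp (R : realType) (q y : R) : 1 <= q <= 2 -> 0 <= y ->
  y `^ q <= (2 - q) * y + (q - 1) * y ^+ 2.
Proof.
move=> /andP[q1 q2]; rewrite le_eqVlt => /predU1P[<-|y0].
  by rewrite powR0 ?expr0n ?mulr0 ?addr0 //; lra.
have q10 : 0 <= q - 1 by lra.
have q11 : q - 1 <= 1 by lra.
have := convex_expR (Itv01 q10 q11) (2 * ln y) (ln y).
rewrite !convRE /= /unstable.onem expRM_natl lnK //.
have -> : (q - 1) * (2 * ln y) + (1 - (q - 1)) * ln y = q * ln y by ring.
rewrite /powR gt_eqF //; lra.
Qed.

(** After division by [k] the entries have l1 norm and squared l2 norm at most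
    [s]; [powR_interp] bounds the q-th power by a convex combination of the
    two. *)
Lemma normpow_interp (R : realType) p (k s q : R) (b : 'cV[R]_p) :
  0 < k -> 1 <= q <= 2 ->
  norm1 b <= k * s -> normpow 2 b <= k ^+ 2 * s ->
  normpow q b <= k `^ q * s.
Proof.
move=> k0 q12 h1 h2; have /andP[q1 q2] := q12.
have -> : normpow q b = k `^ q * \sum_j (`|b j 0| / k) `^ q.
  rewrite mulr_sumr; apply: eq_bigr => j _.
  by rewrite -powRM ?divr_ge0 ?(ltW k0) // mulrC divfK ?gt_eqF.
rewrite ler_wpM2l ?powR_ge0 //.
apply: (@le_trans _ _ ((2 - q) * (norm1 b / k) + (q - 1) * (normpow 2 b / k ^+ 2))).
  rewrite normpow2 /norm1 !mulr_suml !mulr_sumr -big_split /=.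
  apply: ler_sum => j _; rewrite (le_trans (powR_interp q12 _)) ?divr_ge0 ?(ltW k0) //.
  by rewrite expr_div_n real_normK ?num_real.
have {}h1 : norm1 b / k <= s by rewrite ler_pdivrMr // mulrC.
have {}h2 : normpow 2 b / k ^+ 2 <= s by rewrite ler_pdivrMr ?exprn_gt0 // mulrC.
have := ler_wpM2l (_ : 0 <= 2 - q) h1; have := ler_wpM2l (_ : 0 <= q - 1) h2.
lra.
Qed.

(** * Empirical loss *)

Section empirical_loss.
Context {d : measure_display} {T : measurableType d} {R : realType}.
Context (P : probability T R) {F : lmodType R} (L : F -> T -> R).
Context {p : nat} (psi : 'I_p -> F).
Implicit Types b : 'cV[R]_p.

(** The excess risk is a difference of empirical losses, here nonpositive, plus
    an increment of the empirical process. *)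
Lemma excess_risk_le bstar M eps w b :
  (sup_process P L psi bstar M w <= eps%:E)%E -> norm1 (b - bstar) <= M ->
  L (lincomb psi b) w <= L (lincomb psi bstar) w ->
  excess_risk P L (lincomb psi bstar) (lincomb psi b) <= eps.
Proof.
move=> Z_le bM Lb.
have : `|emp_process P L psi b w - emp_process P L psi bstar w| <= eps.
  rewrite -lee_fin; apply: le_trans Z_le; apply: ereal_sup_ubound.
  by exists b.
rewrite ler_norml => /andP[+ _]; rewrite /emp_process /excess_risk; lra.
Qed.

Lemma convex_le_segment w b b' (t : R) :
  convex_function setT (fun b : 'cV[R]_p => L (lincomb psi b) w) ->
  0 <= t <= 1 -> L (lincomb psi b') w <= L (lincomb psi b) w ->
  L (lincomb psi (b + t *: (b' - b))) w <= L (lincomb psi b) w.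
Proof.
move=> cvx /andP[t0 t1] Lb.
have := cvx (Itv01 t0 t1) b' b (in_setT _) (in_setT _).
have -> : conv (Itv01 t0 t1) (b' : convex_lmodType 'cV[R]_p) b
    = b + t *: (b' - b).
  rewrite /conv /= /unstable.onem scalerBr scalerBl scale1r.
  by rewrite addrCA addrA.
rewrite convRE /= /unstable.onem => /le_trans; apply.
have := ler_wpM2l t0 Lb; lra.
Qed.

End empirical_loss.

(** * Rates of convergence *)

Theorem theorem3p2 (R : realType) (d : measure_display) (T : measurableType d)
    (P : probability T R) (F : lmodType R) (ip : {dot F for idfun})
    (L : F -> T -> R)
    (L_int : forall f, P.-integrable setT (EFin \o L f))
    (f0 : F) (f0_min : forall f, risk P L f0 <= risk P L f)
    (p : nat) (psi : 'I_p -> F)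
    (bhat : T -> 'cV[R]_p) (bhat_est : nonneg_estimator L psi bhat)
    (bstar : 'cV[R]_p) (bstar_ge0 : vnonneg bstar)
    (L_convex : forall w,
       convex_function setT (fun b : 'cV[R]_p => L (lincomb psi b) w))
    (c : R) (c_gt0 : 0 < c) (Flocal : set F)
    (margin : forall f, Flocal f ->
       c * inorm ip (f - f0) ^+ 2 <= excess_risk P L f0 f)
    (tau : R) (tau_gt0 : 0 < tau)
    (pos_eig : positive_eigenvalue (gram ip psi) tau)
    (Sstar_neq0 : vsupp bstar != finset.set0)
    (phi : R) (phi_gt0 : 0 < phi) (phi_le1 : phi <= 1)
    (restr_eig : restricted_eigenvalue (gram ip psi)
       (3 * maxnorm2 ip psi / tau ^+ 2) (vsupp bstar) (2 * #|vsupp bstar|) phi)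
    (lambda : R) (lambda_gt0 : 0 < lambda) :
  let sstar : R := #|vsupp bstar|%:R in
  let K := rate_const c phi tau (maxnorm2 ip psi) in
  let eps := 4 * excess_risk P L f0 (lincomb psi bstar)
             + K * sstar * lambda ^+ 2 in
  let M := eps / lambda in
  f0 = lincomb psi bstar ->
  (forall b : 'cV[R]_p, norm1 (b - bstar) <= M -> Flocal (lincomb psi b)) ->
  forall w, (sup_process P L psi bstar M w <= eps%:E)%E ->
  forall q : R, 1 <= q <= 2 ->
    normpow q (bhat w - bstar) <= K `^ q * sstar * lambda `^ q.

Proof.
move=> s K eps M f0E loc w Z_le q q12.
have [_ /(_ w) [bhat_ge0 bhat_min]] := bhat_est.
set D := bhat w - bstar.
pose La := 3 * maxnorm2 ip psi / tau ^+ 2.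
pose B := (1 + La) ^+ 2 / phi ^+ 2.
have s1 : 1 <= s by rewrite ler1n card_gt0.
have /finset.set0Pn[j0 j0S] := Sstar_neq0.
have C0 : 0 <= maxnorm2 ip psi := le_trans (normr_ge0 _) (ip_le_maxnorm2 ip psi j0 j0).
have La0 : 0 <= La by rewrite divr_ge0 ?mulr_ge0 ?exprn_ge0 ?(ltW tau_gt0).
have B0 : 0 < B by rewrite divr_gt0 ?exprn_gt0 ?(ltr_wpDr La0 ltr01).
have KB : K = 12 * B / c.
  by rewrite /K /rate_const -/La /B; field; rewrite !gt_eqF.
have cB0 : 0 < 12 * B / c by apply: divr_gt0 => //; apply: mulr_gt0; rewrite ?ltr0n.
have K0 : 0 < K by rewrite KB.
have epsE : eps = K * s * lambda ^+ 2.
  by rewrite /eps f0E /excess_risk subrr mulr0 add0r.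
have ME : M = K * s * lambda.
  by rewrite /M epsE; field; rewrite gt_eqF.
have M0 : 0 < M.
  by rewrite ME; exact: mulr_gt0 (mulr_gt0 K0 (lt_le_trans ltr01 s1)) lambda_gt0.
(* The localisation step: inside the ball of radius [M] the bounds improve by
   a factor of two. *)
have bound (t : R) : 0 < t <= 1 -> norm1 (t *: D) <= M ->
    norm1 (t *: D) <= M / 2 /\
    normpow 2 (t *: D) <= (K * lambda) ^+ 2 * s.
  move=> /andP[t0 t1] tM; pose b := bstar + t *: D.
  have bE : b - bstar = t *: D by rewrite /b addrC addKr.
  have Lb : L (lincomb psi b) w <= L (lincomb psi bstar) w.
    by apply: convex_le_segment; rewrite ?(ltW t0) ?bhat_min.
  have ex : excess_risk P L f0 (lincomb psi b) <= eps.
    by rewrite f0E; apply: (excess_risk_le Z_le); rewrite ?bE.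
  have cQ : c * quadform (gram ip psi) (t *: D) <= eps.
    rewrite quadform_gram -bE lincombB -inorm_sqr -f0E.
    by apply: le_trans ex; apply: margin; apply: loc; rewrite bE.
  have tD0 j : j \notin vsupp bstar -> 0 <= (t *: D) j 0.
    rewrite inE negbK => /eqP bj; rewrite !mxE bj subr0.
    by rewrite mulr_ge0 ?(ltW t0) ?bhat_ge0.
  have [] := norm_bounds tau_gt0 phi_gt0 Sstar_neq0 pos_eig restr_eig tD0.
  rewrite -/La -/B -/s => n1 n2.
  have BQ : 12 * (B * quadform (gram ip psi) (t *: D)) <= K ^+ 2 * s * lambda ^+ 2.
    have := ler_wpM2l (ltW cB0) cQ.
    rewrite -KB epsE.
    have -> : K * (c * quadform (gram ip psi) (t *: D))
       = 12 * (B * quadform (gram ip psi) (t *: D)).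
      by rewrite KB; field; rewrite gt_eqF.
    by have -> : K * (K * s * lambda ^+ 2) = K ^+ 2 * s * lambda ^+ 2 by ring.
  have Q0 : 0 <= B * quadform (gram ip psi) (t *: D).
    exact: le_trans (normpow2_ge0 _) n2.
  split; last by rewrite exprMn; lra.
  have M20 : 0 <= M / 2 by lra.
  rewrite -(@ler_pXn2r _ 2) ?nnegrE ?norm1_ge0 ?M20 //.
  apply: (le_trans n1).
  have : 12 * (s * (B * quadform (gram ip psi) (t *: D))) <= M ^+ 2.
    have -> : M ^+ 2 = s * (K ^+ 2 * s * lambda ^+ 2) by rewrite ME; ring.
    by rewrite mulrCA ler_wpM2l //; lra.
  have := mulr_ge0 (le_trans ler01 s1) Q0; lra.
have DM : norm1 D <= M.
  have nD := norm1_ge0 D.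
  have MD : 0 < M + norm1 D by rewrite ltr_pwDl.
  (* This fraction brings any [D] into the ball of radius [M], and
     [norm1 (r *: D) <= M / 2] says exactly that [norm1 D <= M]. *)
  pose r := M / (M + norm1 D).
  have r0 : 0 < r by rewrite divr_gt0.
  have rD : norm1 (r *: D) = M * norm1 D / (M + norm1 D).
    by rewrite norm1Z gtr0_norm // mulrAC.
  have r1 : 0 < r <= 1 by rewrite r0 ler_pdivrMr // mul1r lerDl.
  have rM : norm1 (r *: D) <= M.
    by rewrite rD ler_pdivrMr // ler_pM2l // lerDr ltW.
  have [+ _] := bound r r1 rM.
  by rewrite rD ler_pdivrMr // => h; rewrite -(ler_pM2l M0); lra.
have [_ n2] : norm1 D <= M / 2 /\ normpow 2 D <= (K * lambda) ^+ 2 * s.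
  by rewrite -[D]scale1r; apply: bound; rewrite ?scale1r ?ltr01 ?lexx.
rewrite mulrAC -powRM ?(ltW K0) ?(ltW lambda_gt0) //.
apply: normpow_interp => //; first exact: mulr_gt0.
by rewrite mulrAC -ME.
Qed.
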